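(* Let $\mathbb{K}$ be an algebraically closed field of characteristic $0$. For any Lie algebra $\mathfrak{g}$ over $\mathbb{K}$, with dual $\mathfrak{g}$-module $\mathfrak{g}^*$, $$\operatorname{HL}^2(\mathfrak{g},\mathbb{K})=\operatorname{H}^1(\mathfrak{g},\mathfrak{g}^* )=\operatorname{Der}(\mathfrak{g},\mathfrak{g}^* )/\operatorname{Inn}(\mathfrak{g},\mathfrak{g}^* )$$ (where equality means isomorphism of $\mathbb{K}$-vector spaces).
   Context: $\operatorname{HL}^2(\mathfrak{g},\mathbb{K})$ is the second Leibniz cohomology group with trivial coefficients: the space of bilinear forms $\alpha$ on $\mathfrak{g}$ with $\alpha(x,[y,z])=\alpha([x,y],z)-\alpha([x,z],y)$ for all $x,y,z\in\mathfrak{g}$, modulo those of the form $(x,y)\mapsto-\beta([x,y])$ with $\beta\in\mathfrak{g}^*$. The dual module is $\mathfrak{g}^*=\operatorname{Hom}_{\mathbb{K}}(\mathfrak{g},\mathbb{K})$ with action $(x\cdot\xi)(y)=\xi([y,x])$. For a $\mathfrak{g}$-module $M$, $\operatorname{Der}(\mathfrak{g},M)$ is the space of linear maps $d:\mathfrak{g}\to M$ with $d([x,y])=x\cdot d(y)-y\cdot d(x)$ for all $x,y\in\mathfrak{g}$, and $\operatorname{Inn}(\mathfrak{g},M)$ is the subspace of maps $x\mapsto x\cdot m$ with $m\in M$. $\operatorname{H}^1(\mathfrak{g},M)$ is the first Chevalley--Eilenberg cohomology group. *)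

(* Defs.v *)
From HB Require Import structures.
From mathcomp Require Import all_boot all_order all_algebra.
From mathcomp Require Import boolp classical_sets functions.

Set Implicit Arguments.
Unset Strict Implicit.
Unset Printing Implicit Defensive.

Import GRing.Theory.

Local Open Scope ring_scope.
Local Open Scope quotient_scope.

(* The quotient space Z / B of two subspaces of V, built as the quotient of the
   subtype of Z by the trace of B on it.  It is meant for B included in Z; for
   arbitrary Z and B it is Z / (Z :&: B). *)
Section SubQuotient.
Variables (K : fieldType) (V : lmodType K) (Z B : submodClosed V).

Definition subspace := {x : V | x \in Z}.

HB.instance Definition _ := SubChoice.on subspace.

Fact subspace_closed : subsemimod_closed (Z : {pred V}).
Proof.
split; first by split; [exact: rpred0 | exact: rpredD].
by move=> a x xZ; exact: rpredZ.
Qed.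

HB.instance Definition _ :=
  GRing.SubChoice_isSubLmodule.Build K V (fun x => x \in Z) subspace
    subspace_closed.

Definition sub_trace : {pred subspace} := fun z => val z \in B.

Fact sub_trace_closed : subsemimod_closed sub_trace.
Proof.
have memE z : (z \in sub_trace) = (val z \in B) by [].
split; first split.
- by rewrite memE raddf0 rpred0.
- by move=> x y; rewrite !memE raddfD; exact: rpredD.
- by move=> a x; rewrite !memE linearZ; exact: rpredZ.
Qed.

HB.instance Definition _ :=
  GRing.isSubmodClosed.Build K subspace sub_trace sub_trace_closed.

Definition subquot := Quotient.quot sub_trace.

HB.instance Definition _ := GRing.Zmodule.on subquot.

Definition subquot_scale (a : K) (x : subquot) : subquot :=
  \pi_subquot (a *: repr x).

Lemma subquot_eqP (x y : subspace) :
  reflect (\pi_subquot x = \pi_subquot y) (val x - val y \in B).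
Proof.
rewrite -raddfB; apply: (iffP idP) => [xyB | /eqP].
  by apply/eqP; rewrite -[_ == _](Quotient.idealrBE sub_trace x y).
by rewrite -[_ == _](Quotient.idealrBE sub_trace x y).
Qed.

Fact pi_scale a (x : subspace) :
  \pi_subquot (a *: x) = subquot_scale a (\pi_subquot x).
Proof.
have valZ (y : subspace) : val (a *: y) = a *: val y by [].
apply/subquot_eqP; rewrite !valZ -scalerBr; apply: rpredZ.
by apply/subquot_eqP; rewrite reprK.
Qed.

Lemma subquot_surj (u : subquot) : exists x, u = \pi_subquot x.
Proof. by exists (repr u); rewrite reprK. Qed.

Lemma pi_add (x y : subspace) :
  \pi_subquot (x + y) = \pi_subquot x + \pi_subquot y.
Proof. exact: raddfD. Qed.

Fact subquot_scaleA a b u :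
  subquot_scale a (subquot_scale b u) = subquot_scale (a * b) u.
Proof. by have [x ->] := subquot_surj u; rewrite -!pi_scale scalerA. Qed.

Fact subquot_scale1 : left_id 1 subquot_scale.
Proof. by move=> u; have [x ->] := subquot_surj u; rewrite -pi_scale scale1r. Qed.

Fact subquot_scaleDr : right_distributive subquot_scale +%R.
Proof.
move=> a u v; have [x ->] := subquot_surj u; have [y ->] := subquot_surj v.
by rewrite -pi_add -!pi_scale -pi_add scalerDr.
Qed.

Fact subquot_scaleDl u : {morph subquot_scale^~ u : a b / a + b}.
Proof.
move=> a b; have [x ->] := subquot_surj u.
by rewrite -!pi_scale -pi_add scalerDl.
Qed.

HB.instance Definition _ := GRing.Zmodule_isLmodule.Build K subquot
  subquot_scaleA subquot_scale1 subquot_scaleDr subquot_scaleDl.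

End SubQuotient.

Definition lmod_isomorphic (K : fieldType) (V W : lmodType K) : Prop :=
  exists f : {linear V -> W}, bijective f.

HB.mixin Record isLieAlgebra (K : fieldType) (g : Type) of GRing.Lmodule K g := {
  bracket : g -> g -> g;
  bracket_linearl : forall y : g, linear (bracket^~ y);
  bracket_linearr : forall x : g, linear (bracket x);
  bracketxx : forall x : g, bracket x x = 0;
  bracket_jacobi : forall x y z : g,
    bracket x (bracket y z) + bracket y (bracket z x)
      + bracket z (bracket x y) = 0
}.

#[short(type="lieAlgType")]
HB.structure Definition LieAlgebra (K : fieldType) :=
  {g of GRing.Lmodule K g & isLieAlgebra K g}.

HB.mixin Record isLieModule (K : fieldType) (g : lieAlgType K) (M : Type)
    of GRing.Lmodule K M := {
  act : g -> M -> M;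
  act_linearl : forall m : M, linear (act^~ m);
  act_linearr : forall x : g, linear (act x);
  act_bracket : forall (x y : g) (m : M),
    act (bracket x y) m = act x (act y m) - act y (act x m)
}.

#[short(type="lieModType")]
HB.structure Definition LieModule (K : fieldType) (g : lieAlgType K) :=
  {M of GRing.Lmodule K M & isLieModule K g M}.

Section LieAlgebraTheory.
Variables (K : fieldType) (g : lieAlgType K).
Implicit Types x y z : g.

Lemma bracketDl y : {morph bracket^~ y : x x' / x + x'}.
Proof. by move=> x x'; have := bracket_linearl y 1 x x'; rewrite !scale1r. Qed.

Lemma bracketDr x : {morph bracket x : y y' / y + y'}.
Proof. by move=> y y'; have := bracket_linearr x 1 y y'; rewrite !scale1r. Qed.

Lemma bracketC x y : bracket x y = - bracket y x.
Proof.
apply/eqP; rewrite -addr_eq0; apply/eqP; have := bracketxx (x + y).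
by rewrite bracketDl !bracketDr !bracketxx add0r addr0.
Qed.

Lemma bracketNr x y : bracket x (- y) = - bracket x y.
Proof.
apply/eqP; rewrite -addr_eq0 -bracketDr addNr; apply/eqP.
by apply: (addrI (bracket x 0)); rewrite -bracketDr !addr0.
Qed.

Lemma bracket_leibniz x y z :
  bracket x (bracket y z) = bracket (bracket x y) z - bracket (bracket x z) y.
Proof.
have /eqP := bracket_jacobi x y z; rewrite -addrA addr_eq0 => /eqP ->.
rewrite (bracketC z x) bracketNr (bracketC y) (bracketC z (bracket x y)).
by rewrite opprK opprD opprK addrC.
Qed.

End LieAlgebraTheory.

Section Dual.
Variables (K : fieldType) (g : lieAlgType K).

Definition linear_form : {pred g -> K^o} := fun f => `[< scalar f >].

Fact linear_form_closed : subsemimod_closed linear_form.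
Proof.
split; first split.
- by apply/asboolP => a x y; rewrite /= mulr0 addr0.
- move=> f h /asboolP lf /asboolP lh; apply/asboolP => a x y.
  by rewrite !addrfctE lf lh mulrDr addrACA.
- move=> b f /asboolP lf; apply/asboolP => a x y.
  by rewrite !scalrfctE lf scalerDr; congr (_ + _); exact: mulrCA.
Qed.

HB.instance Definition _ :=
  GRing.isSubmodClosed.Build K (g -> K^o) linear_form linear_form_closed.

Definition dual := subspace linear_form.

HB.instance Definition _ := GRing.Lmodule.on dual.

Definition dual_eval (xi : dual) : g -> K^o := val xi.
Coercion dual_eval : dual >-> Funclass.

Lemma dual_scalar (xi : dual) : scalar xi.
Proof. exact/asboolP/(valP xi). Qed.

Lemma dualD (xi : dual) : {morph xi : x y / x + y}.
Proof. by move=> x y; have := dual_scalar xi 1 x y; rewrite scale1r mul1r. Qed.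

Lemma dualB (xi : dual) : {morph xi : x y / x - y}.
Proof.
move=> x y; have := dual_scalar xi (-1) y x.
by rewrite scaleN1r mulN1r [- y + x]addrC [- xi y + _]addrC.
Qed.

Lemma dualP (xi ze : dual) : (forall x, xi x = ze x) -> xi = ze.
Proof. by move=> e; apply: val_inj; apply/funext. Qed.

Fact dual_act_subproof (x : g) (xi : dual) :
  (fun y => xi (bracket y x)) \in linear_form.
Proof.
by apply/asboolP => a y z /=; rewrite bracket_linearl dual_scalar.
Qed.

Definition dual_act (x : g) (xi : dual) : dual :=
  exist _ (fun y => xi (bracket y x)) (dual_act_subproof x xi).

Fact dual_act_linearl xi : linear (dual_act^~ xi).
Proof.
move=> a x y; apply: dualP => z; rewrite /dual_eval /=.
by rewrite bracket_linearr; exact: dual_scalar.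
Qed.

Fact dual_act_linearr x : linear (dual_act x).
Proof. by move=> a xi ze; apply: dualP. Qed.

Fact dual_act_bracket x y xi :
  dual_act (bracket x y) xi
    = dual_act x (dual_act y xi) - dual_act y (dual_act x xi).
Proof.
apply: dualP => z; rewrite /dual_eval /=.
by rewrite bracket_leibniz; exact: dualB.
Qed.

HB.instance Definition _ := isLieModule.Build K g dual
  dual_act_linearl dual_act_linearr dual_act_bracket.

End Dual.

Section LeibnizCohomology.
Variables (K : fieldType) (g : lieAlgType K).

Definition HL2_cocycle : {pred g -> g -> K^o} := fun alpha =>
  `[< [/\ forall x, scalar (alpha x), forall y, scalar (alpha^~ y)
        & forall x y z, alpha x (bracket y z)
            = alpha (bracket x y) z - alpha (bracket x z) y] >].

Definition HL2_coboundary : {pred g -> g -> K^o} := fun alpha =>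
  `[< exists beta : dual g, alpha = fun x y => - beta (bracket x y) >].

Fact HL2_cocycle_closed : subsemimod_closed HL2_cocycle.
Proof.
split; first split.
- apply/asboolP; split=> [x a y z|x a y z|x y z].
  + by rewrite /= mulr0 addr0.
  + by rewrite /= mulr0 addr0.
  + by rewrite subr0.
- move=> f h /asboolP[f1 f2 f3] /asboolP[h1 h2 h3].
  apply/asboolP; split=> [x a y z|x a y z|x y z]; rewrite !addrfctE.
  + by rewrite f1 h1 mulrDr addrACA.
  + by have /= -> := f2 x a y z; have /= -> := h2 x a y z; rewrite mulrDr addrACA.
  + by rewrite f3 h3 opprD addrACA.
- move=> b f /asboolP[f1 f2 f3].
  apply/asboolP; split=> [x a y z|x a y z|x y z]; rewrite !scalrfctE.
  + by rewrite f1 scalerDr; congr (_ + _); exact: mulrCA.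
  + have /= -> := f2 x a y z.
    by rewrite scalerDr; congr (_ + _); exact: mulrCA.
  + by rewrite f3 scalerBr.
Qed.

HB.instance Definition _ :=
  GRing.isSubmodClosed.Build K (g -> g -> K^o) HL2_cocycle HL2_cocycle_closed.

Fact HL2_coboundary_closed : subsemimod_closed HL2_coboundary.
Proof.
split; first split.
- by apply/asboolP; exists 0; do 2!apply/funext => ?; rewrite oppr0.
- move=> f h /asboolP[b ->] /asboolP[c ->]; apply/asboolP; exists (b + c).
  by do 2!apply/funext => ?; rewrite !addrfctE -opprD.
- move=> a f /asboolP[b ->]; apply/asboolP; exists (a *: b).
  by do 2!apply/funext => ?; rewrite !scalrfctE scalerN.
Qed.

HB.instance Definition _ :=
  GRing.isSubmodClosed.Build K (g -> g -> K^o) HL2_coboundary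
    HL2_coboundary_closed.

Lemma HL2_coboundary_cocycle : {subset HL2_coboundary <= HL2_cocycle}.
Proof.
move=> _ /asboolP[b ->]; apply/asboolP; split=> [x a y z|x a y z|x y z] /=.
- by rewrite bracket_linearr dual_scalar opprD mulrN.
- by rewrite bracket_linearl dual_scalar opprD mulrN.
- by rewrite bracket_leibniz dualB opprB opprK addrC.
Qed.

Definition HL2 := subquot HL2_cocycle HL2_coboundary.
HB.instance Definition _ := GRing.Lmodule.on HL2.

End LeibnizCohomology.

Section Derivations.
Variables (K : fieldType) (g : lieAlgType K) (M : lieModType g).

Definition derivation : {pred g -> M} := fun d =>
  `[< linear d /\
      forall x y, d (bracket x y) = act x (d y) - act y (d x) >].

Definition inner_derivation : {pred g -> M} := fun d =>
  `[< exists m : M, d = fun x => act x m >].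

Lemma actDr x : {morph act x : m m' / m + m' :> M}.
Proof. by move=> m m'; have := act_linearr x 1 m m'; rewrite !scale1r. Qed.

Lemma act0r x : act x 0 = 0 :> M.
Proof. by apply: (addrI (act x 0)); rewrite -actDr !addr0. Qed.

Lemma actZr x a (m : M) : act x (a *: m) = a *: act x m.
Proof. by have := act_linearr x a m 0; rewrite act0r !addr0. Qed.

Fact derivation_closed : subsemimod_closed derivation.
Proof.
split; first split.
- apply/asboolP; split=> [a x y|x y] /=; first by rewrite scaler0 addr0.
  by rewrite !act0r subr0.
- move=> f h /asboolP[f1 f2] /asboolP[h1 h2].
  apply/asboolP; split=> [a x y|x y]; rewrite !addrfctE.
  + by rewrite f1 h1 scalerDr addrACA.
  + by rewrite f2 h2 !actDr opprD addrACA.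
- move=> b f /asboolP[f1 f2].
  apply/asboolP; split=> [a x y|x y]; rewrite !scalrfctE.
  + by rewrite f1 scalerDr !scalerA mulrC.
  + by rewrite f2 !actZr scalerBr.
Qed.

HB.instance Definition _ :=
  GRing.isSubmodClosed.Build K (g -> M) derivation derivation_closed.

Fact inner_derivation_closed : subsemimod_closed inner_derivation.
Proof.
split; first split.
- by apply/asboolP; exists 0; apply/funext => x; rewrite act0r.
- move=> f h /asboolP[m ->] /asboolP[p ->]; apply/asboolP; exists (m + p).
  by apply/funext => x; rewrite actDr.
- move=> a f /asboolP[m ->]; apply/asboolP; exists (a *: m).
  by apply/funext => x; rewrite actZr.
Qed.

HB.instance Definition _ :=
  GRing.isSubmodClosed.Build K (g -> M) inner_derivation inner_derivation_closed.

Lemma inner_derivation_derivation : {subset inner_derivation <= derivation}.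
Proof.
move=> _ /asboolP[m ->]; apply/asboolP; split=> [a x y|x y].
  exact: act_linearl.
exact: act_bracket.
Qed.

Definition outer_der := subquot derivation inner_derivation.
HB.instance Definition _ := GRing.Lmodule.on outer_der.

End Derivations.

Section ChevalleyEilenberg.
Variables (K : fieldType) (g : lieAlgType K) (M : lieModType g).
Implicit Types n : nat.

Definition cochain n : {pred ('I_n -> g) -> M} := fun f =>
  `[< (forall (x : 'I_n -> g) (i : 'I_n),
         linear (fun v : g => f (fun k => if k == i then v else x k))) /\
      (forall (x : 'I_n -> g) (i j : 'I_n),
         i != j -> x i = x j -> f x = 0) >].
Arguments cochain n : clear implicits.

(* For i < j, the arguments ([x_i, x_j], x_0, .., x_n) with x_i and x_j removed
   from the tail: m |-> bump j (bump i m) enumerates the indices other than i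
   and j in increasing order. *)
Definition bracket_args n (x : 'I_n.+1 -> g) (i j : 'I_n.+1) : 'I_n -> g :=
  fun k => if k == 0%N :> nat then bracket (x i) (x j)
           else x (inord (bump j (bump i k.-1))).

(* Indices start at 0, so the signs are (-1)^i and (-1)^(i+j). *)
Definition ce_diff n (f : ('I_n -> g) -> M) : ('I_n.+1 -> g) -> M := fun x =>
  \sum_(i < n.+1) (-1) ^+ i *: act (x i) (f (fun k => x (lift i k)))
  + \sum_(i < n.+1) \sum_(j < n.+1 | (i < j)%N)
      (-1) ^+ (i + j) *: f (bracket_args x i j).

Definition ce_cocycle n : {pred ('I_n -> g) -> M} := fun f =>
  `[< f \in cochain n /\ ce_diff f = 0 >].

Definition ce_coboundary n : {pred ('I_n -> g) -> M} :=
  match n with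
  | 0 => fun f => `[< f = 0 >]
  | m.+1 => fun f => `[< exists2 h, h \in cochain m & f = ce_diff h >]
  end.
Arguments ce_cocycle n : clear implicits.
Arguments ce_coboundary n : clear implicits.

Fact ce_diff_linear n : linear (@ce_diff n).
Proof.
move=> a f h; apply/funext => x.
transitivity (a *: ce_diff f x + ce_diff h x); last by [].
have fhE y : (a *: f + h) y = a *: f y + h y by [].
rewrite /ce_diff scalerDr addrACA.
congr (_ + _); rewrite scaler_sumr -big_split /=.
  apply: eq_bigr => i _; rewrite fhE actDr actZr scalerDr.
  by rewrite !scalerA mulrC.
apply: eq_bigr => i _; rewrite scaler_sumr -big_split /=.
apply: eq_bigr => j _; rewrite fhE scalerDr.
by rewrite !scalerA mulrC.
Qed.

HB.instance Definition _ n :=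
  GRing.isLinear.Build K (('I_n -> g) -> M) (('I_n.+1 -> g) -> M) *:%R
    (@ce_diff n) (@ce_diff_linear n).

Lemma ce_diff0 n : ce_diff (0 : ('I_n -> g) -> M) = 0.
Proof. exact: linear0. Qed.

Lemma ce_diffD n (f h : ('I_n -> g) -> M) :
  ce_diff (f + h) = ce_diff f + ce_diff h.
Proof. exact: linearD. Qed.

Lemma ce_diffZ n a (f : ('I_n -> g) -> M) : ce_diff (a *: f) = a *: ce_diff f.
Proof. exact: linearZ. Qed.

Fact cochain_closed n : subsemimod_closed (cochain n).
Proof.
split; first split.
- by apply/asboolP; split=> // x i a v w /=; rewrite scaler0 addr0.
- move=> f h /asboolP[f1 f2] /asboolP[h1 h2]; apply/asboolP; split.
  + by move=> x i a v w; rewrite !addrfctE f1 h1 scalerDr addrACA.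
  + by move=> x i j ij xij; rewrite addrfctE (f2 _ i j) // (h2 _ i j) // addr0.
- move=> b f /asboolP[f1 f2]; apply/asboolP; split.
  + by move=> x i a v w; rewrite !scalrfctE f1 scalerDr !scalerA mulrC.
  + by move=> x i j ij xij; rewrite scalrfctE (f2 _ i j) // scaler0.
Qed.

HB.instance Definition _ n :=
  GRing.isSubmodClosed.Build K (('I_n -> g) -> M) (cochain n) (@cochain_closed n).

Fact ce_cocycle_closed n : subsemimod_closed (ce_cocycle n).
Proof.
split; first split.
- by apply/asboolP; split; rewrite ?rpred0 ?ce_diff0.
- move=> f h /asboolP[f1 f2] /asboolP[h1 h2]; apply/asboolP.
  by split; [exact: rpredD | rewrite ce_diffD f2 h2 /= addr0].
- move=> b f /asboolP[f1 f2]; apply/asboolP.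
  by split; [exact: rpredZ | rewrite ce_diffZ f2 /= scaler0].
Qed.

HB.instance Definition _ n :=
  GRing.isSubmodClosed.Build K (('I_n -> g) -> M) (ce_cocycle n)
    (@ce_cocycle_closed n).

Fact ce_coboundary_closed n : subsemimod_closed (ce_coboundary n).
Proof.
case: n => [|n]; split; first split.
- exact/asboolP.
- by move=> f h /asboolP -> /asboolP ->; apply/asboolP; rewrite addr0.
- by move=> a f /asboolP ->; apply/asboolP; rewrite scaler0.
- split; first by apply/asboolP; exists 0; rewrite ?rpred0 ?ce_diff0.
  move=> f h /asboolP[u uC ->] /asboolP[v vC ->]; apply/asboolP.
  by exists (u + v); [exact: rpredD | rewrite ce_diffD].
- move=> a f /asboolP[u uC ->]; apply/asboolP.
  by exists (a *: u); [exact: rpredZ | rewrite ce_diffZ].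
Qed.

HB.instance Definition _ n :=
  GRing.isSubmodClosed.Build K (('I_n -> g) -> M) (ce_coboundary n)
    (@ce_coboundary_closed n).

Definition ce_cohomology n := subquot (ce_cocycle n) (ce_coboundary n).
HB.instance Definition _ n := GRing.Lmodule.on (ce_cohomology n).

Lemma ce_diff1E (f : ('I_1 -> g) -> M) (x : 'I_2 -> g) :
  ce_diff f x = act (x ord0) (f (fun=> x ord_max)) - act (x ord_max) (f (fun=> x ord0))
    - f (fun=> bracket (x ord0) (x ord_max)).
Proof.
rewrite /ce_diff !big_ord_recl !big_ord0 /= !addr0.
rewrite !big_mkcond !big_ord_recl !big_ord0 /= !addr0 add0r.
rewrite expr0 scale1r !expr1 !scaleN1r.
have e1 : lift ord0 ord0 = ord_max :> 'I_2 by apply: val_inj.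
rewrite e1 [X in _ + (_ + X)]big1 ?addr0; last by case=> [[|[|j]]].
congr (act _ (f _) - act _ (f _) - f _); apply/funext => k; rewrite ?ord1 /bracket_args //=.
  by congr x; apply: val_inj.
by congr x; apply: val_inj.
Qed.

Lemma ce_diff0E (f : ('I_0 -> g) -> M) (x : 'I_1 -> g) (u : 'I_0 -> g) :
  ce_diff f x = act (x ord0) (f u).
Proof.
rewrite /ce_diff !big_ord_recl !big_ord0 /= !addr0.
rewrite !big_mkcond !big_ord_recl !big_ord0 /= !addr0 expr0 scale1r.
by congr (act _ (f _)); apply/funext => -[].
Qed.

Lemma ce_coboundary1_cocycle :
  {subset ce_coboundary 1 <= ce_cocycle 1}.
Proof.
move=> f /asboolP[h hC ->].
pose u : 'I_0 -> g := fun=> 0.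
apply/asboolP; split.
  apply/asboolP; split=> [x i a v w|x i j].
    by rewrite !(ce_diff0E _ _ u) (ord1 i) /= act_linearl.
  by rewrite !ord1.
apply/funext => x; rewrite ce_diff1E !(ce_diff0E _ _ u) act_bracket.
by rewrite subrr.
Qed.
End ChevalleyEilenberg.

Arguments outer_der {K} g M.
Arguments ce_cohomology {K} g M n.

(* Main.v *)
Require Import Defs.
From HB Require Import structures.
From mathcomp Require Import all_boot all_algebra.
From mathcomp Require Import boolp functions.

Set Implicit Arguments.
Unset Strict Implicit.
Unset Printing Implicit Defensive.

Import GRing.Theory.

Local Open Scope ring_scope.
Local Open Scope quotient_scope.

(** A bilinear form alpha on g is the same thing as the linear map
    d : g -> g^* sending y to alpha(-, y).  The dual action being
    (x . xi)(y) = xi([y, x]), evaluating d([y, z]) = y . d(z) - z . d(y) at x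
    gives alpha(x, [y, z]) = alpha([x, y], z) - alpha([x, z], y): d is a
    derivation exactly when alpha is a Leibniz 2-cocycle.  The inner derivation
    y |-> y . xi corresponds to (x, y) |-> xi([x, y]), the coboundary attached
    to beta = - xi.  So currying identifies both cocycles and coboundaries, and
    HL^2(g, K) = Der(g, g^* ) / Inn(g, g^* )
    ([derivation_form], [inner_derivation_form]).

    For any module M, a 1-cochain is a linear map g -> M; the differential of
    1-cochains measures the failure of the derivation rule and the differential
    of 0-cochains produces the inner derivations, so H^1(g, M) = Der / Inn
    ([derivation_cochain1], [inner_derivation_cochain1]).

    In both cases the identification is the restriction of a linear map defined
    on all functions g -> M, so [subquot_iso] passes it to the quotients. *)

Lemma lmod_isomorphic_sym (K : fieldType) (V W : lmodType K) :
  lmod_isomorphic V W -> lmod_isomorphic W V.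
Proof.
case=> f [h fK hK].
pose hL := GRing.isLinear.Build K W V *:%R h (can2_linear fK hK).
pose hlin : {linear W -> V} := HB.pack h hL.
by exists hlin; exists f.
Qed.

Lemma lmod_isomorphic_trans (K : fieldType) (U V W : lmodType K) :
  lmod_isomorphic U V -> lmod_isomorphic V W -> lmod_isomorphic U W.
Proof.
case=> f bij_f [h bij_h].
by exists (h \o f : {linear U -> W}); exact: bij_comp.
Qed.

Lemma submodB (K : fieldType) (V : lmodType K) (Z : submodClosed V) :
  {in Z &, forall x y, x - y \in Z}.
Proof.
move=> x y xZ yZ; rewrite -scaleN1r.
by apply: rpredD => //; exact: rpredZ.
Qed.

Lemma scale_pi (K : fieldType) (V : lmodType K) (Z B : submodClosed V) a
    (x : subspace Z) :
  a *: (\pi_(subquot Z B) x : subquot Z B) = \pi_(subquot Z B) (a *: x).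
Proof. exact/esym/pi_scale. Qed.

Section SubquotIso.
Variables (K : fieldType) (V W : lmodType K) (f : {linear V -> W}).
Variables (Z B : submodClosed V) (Z' B' : submodClosed W).

(** First isomorphism theorem for f restricted to Z.  That B and the preimage of
    B' have the same trace on Z gives both that the induced map is well defined
    and that it is injective. *)
Lemma subquot_iso :
    {in Z, forall x, f x \in Z'} ->
    {in Z', forall y, exists2 x, x \in Z & f x = y} ->
    {in Z, forall x, (f x \in B') = (x \in B)} ->
  lmod_isomorphic (subquot Z B) (subquot Z' B').
Proof.
move=> fZ fsurj fB.
pose fsub (x : subspace Z) : subspace Z' := exist _ (f (val x)) (fZ _ (valP x)).
pose F (u : subquot Z B) : subquot Z' B' := \pi_(subquot Z' B') (fsub (repr u)).
have FE (x : subspace Z) : F (\pi_(subquot Z B) x) = \pi_(subquot Z' B') (fsub x).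
  apply/subquot_eqP; rewrite /= -raddfB.
  have memZ : val (repr (\pi_(subquot Z B) x)) - val x \in Z.
    by apply: submodB; exact: valP.
  by rewrite fB //; apply/subquot_eqP; rewrite reprK.
have Flin : linear F.
  move=> a u v; have [x ->] := subquot_surj u; have [y ->] := subquot_surj v.
  rewrite scale_pi -Defs.pi_add !FE scale_pi -Defs.pi_add.
  congr (\pi _); apply: val_inj; exact: linearP.
have Finj : injective F.
  move=> u v; have [x ->] := subquot_surj u; have [y ->] := subquot_surj v.
  rewrite !FE => /subquot_eqP; rewrite /= -raddfB fB; last first.
    by apply: submodB; exact: valP.
  by move=> xyB; apply/subquot_eqP.
have Fsurj w : exists u, F u = w.
  have [y ->] := subquot_surj w.
  have [x xZ fx] := fsurj _ (valP y).
  exists (\pi_(subquot Z B) (exist _ x xZ : subspace Z)).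
  by rewrite FE; congr (\pi _); apply: val_inj.
have [G GK] := choice Fsurj.
pose FL := GRing.isLinear.Build K (subquot Z B) (subquot Z' B') *:%R F Flin.
pose Fl : {linear subquot Z B -> subquot Z' B'} := HB.pack F FL.
exists Fl; exists G => // u; apply: Finj; exact: GK.
Qed.

End SubquotIso.

Section Cochain1.
Variables (K : fieldType) (g : lieAlgType K) (M : lieModType g).

Definition cochain1 (d : g -> M) : ('I_1 -> g) -> M := fun x => d (x ord0).

Fact cochain1_linear : linear cochain1.
Proof. by move=> a d e; apply/funext. Qed.

HB.instance Definition _ :=
  GRing.isLinear.Build K (g -> M) (('I_1 -> g) -> M) *:%R cochain1
    cochain1_linear.

Lemma cochain1_surj (f : ('I_1 -> g) -> M) : cochain1 (fun x => f (fun=> x)) = f.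
Proof.
by apply/funext => x; congr f; apply/funext => i; rewrite (ord1 i).
Qed.

Lemma derivation_cochain1 (d : g -> M) :
  (cochain1 d \in @ce_cocycle K g M 1) = (d \in @derivation K g M).
Proof.
apply/asboolP/asboolP => [[/asboolP[dlin _] d0]|[dlin dder]]; split.
- by move=> a x y; have := dlin (fun=> 0) ord0 a x y; rewrite /cochain1 eqxx.
- move=> x y; pose z (i : 'I_2) := if i == ord0 then x else y.
  have := congr1 (@^~ z) d0; rewrite ce_diff1E => /eqP.
  by rewrite subr_eq0 => /eqP.
- apply/asboolP; split=> [x i a v w|x i j]; last by rewrite !ord1.
  by rewrite /cochain1 (ord1 i) eqxx dlin.
- apply/funext => x; rewrite ce_diff1E /cochain1 dder; exact: subrr.
Qed.

(** There is a single empty tuple, so a 0-cochain amounts to an element m of M,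
    and its differential is x |-> x . m. *)
Lemma inner_derivation_cochain1 (d : g -> M) :
  (cochain1 d \in @ce_coboundary K g M 1) = (d \in @inner_derivation K g M).
Proof.
pose u : 'I_0 -> g := fun=> 0.
apply/asboolP/asboolP => [[h _ dh]|[m ->]].
- exists (h u); apply/funext => x.
  by have := congr1 (@^~ (fun=> x)) dh; rewrite (ce_diff0E _ _ u).
- exists (fun=> m); first by apply/asboolP; split=> x [].
  by apply/funext => x; rewrite (ce_diff0E _ _ u).
Qed.

Lemma outer_der_iso_ce_cohomology1 :
  lmod_isomorphic (outer_der g M) (ce_cohomology g M 1).
Proof.
apply: (@subquot_iso _ _ _ cochain1).
- by move=> d; rewrite derivation_cochain1.
- move=> f fZ; exists (fun x => f (fun=> x)); last exact: cochain1_surj.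
  by rewrite -derivation_cochain1 cochain1_surj.
- by move=> d _; exact: inner_derivation_cochain1.
Qed.

End Cochain1.

Section FormOfMap.
Variables (K : fieldType) (g : lieAlgType K).

(** The variables are swapped because the dual action brackets on the right: the
    argument of d is the second argument of the form. *)
Definition form_of_map (d : g -> dual g) : g -> g -> K^o := fun x y => d y x.

Fact form_of_map_linear : linear form_of_map.
Proof. by move=> a d e; do 2!apply/funext => ?. Qed.

HB.instance Definition _ :=
  GRing.isLinear.Build K (g -> dual g) (g -> g -> K^o) *:%R form_of_map
    form_of_map_linear.

Lemma derivation_form (d : g -> dual g) :
  (form_of_map d \in @HL2_cocycle K g) = (d \in @derivation K g (dual g)).
Proof.
apply/asboolP/asboolP => [[d1 _ d3]|[dlin dder]].
- split=> [a x y|x y]; apply: dualP => z; first exact: d1.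
  exact: d3.
- split=> [x a y z|y|x y z]; rewrite /form_of_map.
  + by rewrite dlin.
  + exact: dual_scalar.
  + by rewrite dder.
Qed.

(** A form that is not linear in its first variable comes from no map into the
    dual; hence the correspondence is set up from maps to forms, the direction
    in which it is defined everywhere, and its inverse only on cocycles. *)
Lemma form_of_map_surj (alpha : g -> g -> K^o) :
  alpha \in @HL2_cocycle K g -> exists d, form_of_map d = alpha.
Proof.
move=> /asboolP[_ alphal _].
have alpha_dual y : alpha^~ y \in @linear_form K g by apply/asboolP; exact: alphal.
by exists (fun y => exist _ (alpha^~ y) (alpha_dual y)).
Qed.

Lemma inner_derivation_form (d : g -> dual g) :
  (form_of_map d \in @HL2_coboundary K g)
    = (d \in @inner_derivation K g (dual g)).
Proof.
apply/asboolP/asboolP => [[b db]|[m ->]].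
  (* The coboundary of beta is (x, y) |-> - beta([x, y]), hence the signs. *)
- exists (- b); apply/funext => y; apply: dualP => x.
  exact: (congr1 (fun h => h x y) db).
- exists (- m); do 2!apply/funext => ?; exact: esym (opprK _).
Qed.

Lemma outer_der_iso_HL2 : lmod_isomorphic (outer_der g (dual g)) (HL2 g).
Proof.
apply: (@subquot_iso _ _ _ form_of_map).
- by move=> d; rewrite derivation_form.
- move=> alpha alphaZ; have [d dE] := form_of_map_surj alphaZ.
  by exists d => //; rewrite -derivation_form dE.
- by move=> d _; exact: inner_derivation_form.
Qed.

End FormOfMap.

Theorem theorem3p5 (K : closedFieldType) (char0 : [pchar K] =i pred0)
    (g : lieAlgType K) :
  lmod_isomorphic (HL2 g) (ce_cohomology g (dual g) 1)
  /\ lmod_isomorphic (ce_cohomology g (dual g) 1) (outer_der g (dual g)).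
Proof.
have derH1 := outer_der_iso_ce_cohomology1 (dual g).
split; last exact: lmod_isomorphic_sym.
exact: lmod_isomorphic_trans (lmod_isomorphic_sym (outer_der_iso_HL2 g)) derH1.
Qed.
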